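(* Fix an integer $k\ge1$. For each integer $n\ge1$, let $p_k(n)$ denote the probability that a (uniformly random) $k$-tuple of functions between $k$ sets $X_1,\dots,X_k$ of cardinality $|X_i|=n$ is eventually constant. Then $$p_k(n)=1-\left(1-\frac1n\right)^k.$$ It follows that, as $n\to\infty$, $$p_k(n)=\frac kn+\mathcal O\left(\frac1{n^2}\right).$$
   Context: The sets $X_1,\dots,X_k$ are pairwise disjoint, indices are modulo $k$, and a $k$-tuple of functions means $(f_1,\dots,f_k)$ with $f_i:X_i\to X_{i+1}$ ($X_{k+1}=X_1$); there are $n^{kn}$ such tuples and $p_k(n)$ is the proportion that are eventually constant. The tuple is eventually constant if $(f_k\cdots f_1)^m:X_1\to X_1$ is constant for some $m\ge1$. *)

(* Defs.v *)
From HB Require Import structures.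
From mathcomp Require Import all_boot all_order all_algebra.
From mathcomp Require Import all_classical all_reals all_analysis.

Set Implicit Arguments.
Unset Strict Implicit.
Unset Printing Implicit Defensive.

Import Order.TTheory GRing.Theory Num.Theory.
Import numFieldNormedType.Exports.
Local Open Scope ring_scope.

Section TuplesOfFunctions.
Variables (k : nat) (X : 'I_k -> finType).

(* [ordS] is the successor modulo [k], so [f i : X i -> X (i + 1)] with the
   last function mapping back into the first set. *)
Definition ftuple : finType := {dffun forall i : 'I_k, {ffun X i -> X (ordS i)}}.

(* The union of the [X i] is the sigma type [{i & X i}], in which the [X i] are
   pairwise disjoint even when they coincide as types. *)
Definition fstep (f : ftuple) (u : {i : 'I_k & X i}) : {i : 'I_k & X i} :=
  Tagged (fun i => X i) (f (tag u) (tagged u)).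

Lemma tag_iter_fstep f m u : tag (iter m (fstep f) u) = iter m (@ordS k) (tag u).
Proof. by elim: m => //= m ->. Qed.

Lemma iter_ordS_val m (i : 'I_k) : iter m (@ordS k) i = ((i + m) %% k)%N :> nat.
Proof.
elim: m => [|m IHm] /=; first by rewrite addn0 modn_small.
by rewrite IHm -addn1 modnDml addn1 addnS.
Qed.

Lemma tag_iter_fstep_k f (i : 'I_k) (x : X i) :
  tag (iter k (fstep f) (Tagged (fun i => X i) x)) = i.
Proof.
by apply: val_inj; rewrite tag_iter_fstep /= iter_ordS_val modnDr modn_small.
Qed.

(* The composite of the [k] functions once around the cycle starting from [X i];
   after [k] steps one is back in [X i], up to the cast [etagged]. *)
Definition fcomposite (f : ftuple) (i : 'I_k) (x : X i) : X i :=
  etagged (tag_iter_fstep_k f x).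

Definition eventually_constant (k_gt0 : (0 < k)%N) (f : ftuple) : Prop :=
  exists2 m : nat, (1 <= m)%N &
    exists c : X (Ordinal k_gt0),
      forall x, iter m (@fcomposite f (Ordinal k_gt0)) x = c.

Definition prob_eventually_constant (R : realType) (k_gt0 : (0 < k)%N) : R :=
  #|[set f : ftuple | `[< eventually_constant k_gt0 f >]]|%:R / #|ftuple|%:R.

End TuplesOfFunctions.

(* Main.v *)
(** View the tuple as one map [g] on the disjoint union of the [X i] that
raises the color by one. It is eventually constant iff there is a (necessarily
unique) transversal [r] which [g] permutes cyclically and no nonempty
[g]-invariant set avoids [r].

The count rests on the following identity: if the points of [S], a subset of
[Y], choose their images uniformly in the next color class of [Y], then [S]
contains a nonempty invariant set with probability [prod_i |S_i| / |Y_i|].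
Indeed, let [U] be the set of points of [S] whose image is in [S]. An invariant
subset of [S] lies in [U]; given [U], the points of [U] choose their images
uniformly in [S], so by induction the conditional probability is
[prod_i |U_i| / |S_i|], and its expectation is [prod_i |S_i| / |Y_i|] since
the colors are independent and each point of [S_i] lies in [U] with
probability [|S_(i+1)| / |Y_(i+1)|].

Taking for [S] the complement of [r], the maps attracted to [r] make up a
fraction [(prod_i 1/n_i) (1 - prod_i (1 - 1/n_i))] of all maps, and there are
[prod_i n_i] transversals. *)

Require Import Defs.
From mathcomp Require Import all_boot all_order all_algebra.
From mathcomp Require Import ring lra.

Set Implicit Arguments.
Unset Strict Implicit.
Unset Printing Implicit Defensive.

Import Order.TTheory GRing.Theory Num.Theory.
Local Open Scope ring_scope.

(** * Invariant sets of color-raising maps, and the count of maps that have one *)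

Section Traps.
Variables (k : nat) (Z : finType) (col : Z -> 'I_k) (F : numFieldType).
Implicit Types (S Y U : {set Z}) (g : {ffun Z -> Z}) (Q : Z -> {set Z}).

Definition colored S (i : 'I_k) : {set Z} := [set z in S | col z == i].

Definition targets Y (z : Z) : {set Z} := colored Y (ordS (col z)).

Definition trap g S : bool :=
  [exists A : {set Z},
    [&& A != set0, A \subset S & [forall z in A, g z \in A]]].

Definition survivors g S : {set Z} := [set z in S | g z \in S].

Lemma trapP g S :
  reflect (exists A : {set Z},
             [/\ exists z, z \in A, A \subset S & {in A, forall z, g z \in A}])
          (trap g S).
Proof.
apply: (iffP existsP) => -[A].
  case/and3P=> /set0Pn A0 AS /forall_inP gA; by exists A.
case=> A0 AS gA; exists A; apply/and3P; split=> //; first exact/set0Pn.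
exact/forall_inP.
Qed.

Lemma trap_survivors g S : trap g S = trap g (survivors g S).
Proof.
apply/trapP/trapP => -[A [A0 AS gA]]; exists A; split=> //.
  by apply/subsetP => z zA; rewrite inE (subsetP AS) //= (subsetP AS) ?gA.
by apply: subset_trans AS _; apply/subsetP => z; rewrite inE => /andP[].
Qed.

Lemma iter_ordS_reach (i j : 'I_k) : exists m, iter m (@ordS k) i = j.
Proof.
exists (k - i + j)%N; apply: val_inj; rewrite /= iter_ordS_val addnA subnKC; last exact: ltnW.
by rewrite modnDl modn_small.
Qed.

Lemma iter_invariant (T : finType) (A : {set T}) (h : T -> T) z m :
  {in A, forall z, h z \in A} -> z \in A -> iter m h z \in A.
Proof. by move=> hA zA; elim: m => //= m /hA. Qed.

Lemma col_iter (A : {set Z}) g z m :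
    {in A, forall z, g z \in A} -> {in A, forall z, col (g z) = ordS (col z)} ->
  z \in A -> col (iter m g z) = iter m (@ordS k) (col z).
Proof.
by move=> gA cA zA; elim: m => //= m <-; rewrite cA // iter_invariant.
Qed.

(** The orbit of [z] stays in [A] and runs through all colors, since [ordS] is a single cycle. *)
Lemma invariant_colored (A : {set Z}) g z i :
    {in A, forall z, g z \in A} -> {in A, forall z, col (g z) = ordS (col z)} ->
  z \in A -> exists2 w, w \in A & col w = i.
Proof.
move=> gA cA zA; have [m mi] := iter_ordS_reach (col z) i.
exists (iter m g z); first exact: iter_invariant.
by rewrite (col_iter _ gA cA).
Qed.

Lemma trap_colored g S i :
    {in S, forall z, col (g z) = ordS (col z)} -> trap g S ->
  colored S i != set0.
Proof.
move=> cS /trapP[A [[z zA] AS gA]].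
have [|w wA wi] := @invariant_colored A g z i gA _ zA.
  by move=> y yA; rewrite cS // (subsetP AS).
by apply/set0Pn; exists w; rewrite inE (subsetP AS) // wi eqxx.
Qed.

Lemma natr_card_family (I T : finType) (Q : I -> {set T}) :
  (#|family Q|)%:R = \prod_i #|Q i|%:R :> F.
Proof.
under [RHS]eq_bigr do rewrite -sum1_card natr_sum.
rewrite bigA_distr_big_dep /= -sum1_card natr_sum.
by apply: eq_bigr => g _; rewrite big1.
Qed.

Lemma natr_sum_mem (T : finType) (A B : {set T}) :
  \sum_(w in A) (w \in B)%:R = #|A :&: B|%:R :> F.
Proof.
rewrite -natr_sum -sum1_card; congr _%:R.
rewrite big_mkcond [RHS]big_mkcond; apply: eq_bigr => w _; rewrite inE.
by do 2!case: (_ \in _).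
Qed.

(** Cardinals of families of maps are products over all points; this brings a product over colors to
    that shape, so that the two can be merged factor by factor. *)
Lemma prod_section (phi : 'I_k -> Z) (h : Z -> F) :
    (forall i, col (phi i) = i) ->
  \prod_i h (phi i) = \prod_z (if z == phi (col z) then h z else 1).
Proof.
move=> colphi; rewrite -big_mkcond /=.
rewrite (reindex_onto phi col) /=; last by move=> z /eqP.
by apply: eq_bigl => i; rewrite colphi !eqxx.
Qed.

(** The product over colors is the probability that a random choice [phi] of one point of [S] per
    color consists of survivors. For fixed [phi] the chosen points are distinct, so their images are
    independent. *)
Lemma expected_survivors S Y Q :
    S \subset Y -> {in S, forall z, Q z = targets Y z} ->
    (forall i, colored S i != set0) ->
  \sum_(g in family Q) \prod_i (#|colored (survivors g S) i|%:R / #|colored S i|%:R) =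
  #|family Q|%:R * \prod_i (#|colored S i|%:R / #|colored Y i|%:R) :> F.
Proof.
move=> SY QS S0.
have S0r i : #|colored S i|%:R != 0 :> F by rewrite pnatr_eq0 cards_eq0.
have Y0r i : #|colored Y i|%:R != 0 :> F.
  have /set0Pn[z] := S0 i; rewrite inE => /andP[zS zi].
  rewrite pnatr_eq0 cards_eq0; apply/set0Pn; exists z.
  by rewrite inE (subsetP SY).
have distr g : \prod_i (#|colored (survivors g S) i|%:R / #|colored S i|%:R) =
    (\sum_(phi in family (colored S)) \prod_i (g (phi i) \in S)%:R) /
    \prod_i #|colored S i|%:R :> F.
  rewrite prodf_div; congr (_ / _).
  rewrite -(bigA_distr_big_dep (fun i => mem (colored S i)) (fun i z => (g z \in S)%:R)) /=.
  apply: eq_bigr => i _.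
  rewrite -natr_sum -sum1_card big_mkcond [in RHS]big_mkcond /=; congr _%:R.
  by apply: eq_bigr => z _; rewrite !inE; do !case: (_ \in _); case: (_ == _).
rewrite (eq_bigr _ (fun g _ => distr g)).
rewrite -mulr_suml exchange_big /= prodf_div.
have step (phi : {ffun 'I_k -> Z}) : phi \in family (colored S) ->
  \sum_(g in family Q) \prod_i (g (phi i) \in S)%:R =
  #|family Q|%:R * (\prod_i #|colored S i|%:R / \prod_i #|colored Y i|%:R) :> F.
  move=> /familyP phiS.
  have [phi_S col_phi] : (forall i, phi i \in S) /\ (forall i, col (phi i) = i).
    by split=> i; have := phiS i; rewrite inE => /andP[? /eqP].
  rewrite (eq_bigr _ (fun (g : {ffun Z -> Z}) _ =>
    prod_section (fun z => (g z \in S)%:R) col_phi)).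
  rewrite -(bigA_distr_big_dep (fun z => mem (Q z))
    (fun z w => if z == phi (col z) then (w \in S)%:R else 1 : F)) /=.
  (* The image of [phi i] has color [ordS i]; going once around the cycle, this shift does not
     change the products. *)
  have shift (A : {set Z}) :
      \prod_i #|colored A i|%:R = \prod_i #|colored A (ordS i)|%:R :> F.
    exact: reindex_inj (@ordS_inj k).
  rewrite (shift S) (shift Y) -prodf_div.
  rewrite natr_card_family.
  rewrite -(eq_bigr _ (fun i _ => congr1 (fun i =>
    #|colored S (ordS i)|%:R / #|colored Y (ordS i)|%:R) (col_phi i))).
  rewrite (prod_section (fun z =>
    #|colored S (ordS (col z))|%:R / #|colored Y (ordS (col z))|%:R) col_phi).
  rewrite -big_split /=; apply: eq_bigr => z _.
  (* A point not chosen by [phi] is unconstrained and contributes [#|Q z|]; a chosen one has only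
     the images in [S] left. *)
  case: eqP => [zphi|_]; last by rewrite mulr1 sumr_const.
  have zS : z \in S by rewrite zphi.
  rewrite natr_sum_mem QS // mulrC divfK //.
  congr (#|pred_of_set _|%:R); apply/setP => w; rewrite !inE.
  by have := subsetP SY w; case: (w \in S) => [/(_ isT) ->|_]; rewrite ?andbT ?andbF.
rewrite (eq_bigr _ step) sumr_const -[_ *+ _]mulr_natr.
by rewrite (natr_card_family (colored S)) mulfK //; apply/prodf_neq0.
Qed.

(* [Q] is arbitrary outside [S], so that in the induction step it can encode
   the condition [survivors g S = U]. *)
Lemma card_trap S Y Q (k_gt0 : (0 < k)%N) :
    S \subset Y -> {in S, forall z, Q z = targets Y z} ->
  #|[set g in family Q | trap g S]|%:R =
  #|family Q|%:R * \prod_i (#|colored S i|%:R / #|colored Y i|%:R) :> F.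
Proof.
(* The induction passes from the pair [(S, Y)] to [(U, S)], where [U] is the set of survivors;
   [#|Y|] drops unless [S = Y]. *)
have [n Yn] := ubnP #|Y|; elim: n => // n IHn in S Y Q Yn *.
move=> SY QS.
have colS g : g \in family Q -> {in S, forall z, col (g z) = ordS (col z)}.
  by move=> /familyP gQ z zS; have := gQ z; rewrite QS // inE => /andP[_ /eqP].
(* If [S] misses a color, both sides vanish: a nonempty invariant set meets every color. *)
case: (pickP (fun i => colored S i == set0)) => [i /eqP Si0|S0].
  rewrite (bigD1 i) //= Si0 cards0 mul0r mul0r mulr0.
  apply/eqP; rewrite pnatr_eq0 cards_eq0; apply/eqP/setP => g; rewrite !inE.
  by apply/negP => /andP[gQ /(trap_colored i (colS g gQ))]; rewrite Si0 eqxx.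
have {}S0 i : colored S i != set0 by rewrite S0.
(* If [S = Y], then [S] is itself invariant and every ratio is 1. *)
have [SeY|SneY] := eqVneq S Y.
  subst Y; rewrite big1 ?mulr1; last first.
    by move=> i _; rewrite divff // pnatr_eq0 cards_eq0.
  congr _%:R; apply: eq_card => g; rewrite inE; case gQ: (g \in family Q) => //=.
  apply/trapP; exists S; split=> //.
    have /set0Pn[z] := S0 (Ordinal k_gt0).
    by rewrite inE => /andP[zS _]; exists z.
  move=> z zS; have /familyP/(_ z) := gQ.
  by rewrite QS // inE => /andP[].
rewrite -sum1_card natr_sum.
under eq_bigl do rewrite inE.
rewrite big_mkcondr /=.
rewrite -expected_survivors //.
(* Conditioning on [survivors g S = U] keeps the images independent: points of [U] go into [S],
   other points of [S] go outside [S], and the rest are as before. *)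
pose QU (U : {set Z}) z :=
  if z \in U then targets S z else if z \in S then Q z :\: S else Q z.
have QUE U g : U \subset S ->
    (g \in family (QU U)) = (g \in family Q) && (survivors g S == U).
  move=> US; apply/familyP/andP => [gU|[/familyP gQ /eqP <-] z]; last first.
    rewrite /QU inE; have := gQ z; case: ifP => [/andP[zS gzS]|].
      by rewrite QS // !inE gzS => /andP[_ ->].
    by case: (z \in S) => //= gzS; rewrite inE gzS.
  split.
    apply/familyP => z; have := gU z; rewrite /QU.
    case: ifP => [zU|_]; last by case: ifP => // _; rewrite inE => /andP[].
    by rewrite QS ?(subsetP US) // !inE => /andP[/(subsetP SY) -> ->].
  apply/eqP/setP => z; rewrite inE; have := gU z; rewrite /QU.
  case: ifP => [zU|_]; first by rewrite inE (subsetP US z zU) => /andP[->].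
  by case: ifP => //= zS; rewrite inE => /andP[/negbTE].
have surv_sub g : survivors g S \subset S.
  by apply/subsetP => z; rewrite inE => /andP[].
rewrite (partition_big (survivors^~ S) (fun U : {set Z} => U \subset S)) //=.
rewrite [RHS](partition_big (survivors^~ S) (fun U : {set Z} => U \subset S)) //=.
apply: eq_bigr => U US.
rewrite (eq_bigl [in family (QU U)]); last by move=> g; rewrite /= QUE.
rewrite [RHS](eq_bigl [in family (QU U)]); last by move=> g; rewrite /= QUE.
transitivity (#|[set g in family (QU U) | trap g U]|%:R : F).
  rewrite -sum1_card natr_sum; under [RHS]eq_bigl do rewrite inE.
  rewrite [RHS]big_mkcondr; apply: eq_bigr => g.
  by rewrite /= QUE // => /andP[_ /eqP <-]; rewrite -trap_survivors.
rewrite (IHn U S); last 1 first.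
- by move=> z zU; rewrite /QU zU.
- rewrite mulr_natl -sumr_const; apply: eq_bigr => g.
  by rewrite QUE // => /andP[_ /eqP ->].
- apply: leq_trans (_ : #|Y| <= n)%N => //; apply: proper_card.
  by rewrite properEneq SneY.
- by [].
Qed.

(** * Attracting transversals and the maps that have one *)

Implicit Types r : {ffun 'I_k -> Z}.

Definition transversals := family (colored [set: Z]).

Definition roots r : {set Z} := [set r i | i : 'I_k].

(** Prescribing images pointwise makes the color-raising maps that permute the roots cyclically a
    [family], so [card_trap] applies to them. *)
Definition rooted r z : {set Z} :=
  if z == r (col z) then [set r (ordS (col z))] else targets [set: Z] z.

Definition attractor g r : bool :=
  [&& r \in transversals, g \in family (rooted r) & ~~ trap g (~: roots r)].

Lemma col_transversal r : r \in transversals -> forall i, col (r i) = i.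
Proof. by move=> /familyP rT i; have := rT i; rewrite !inE => /eqP. Qed.

Lemma colored_setC_roots r i : r \in transversals ->
  colored (~: roots r) i = colored [set: Z] i :\ r i.
Proof.
move=> rT; apply/setP => z; rewrite !inE /=.
have [/eqP zi|] := boolP (col z == i); rewrite ?andbF // !andbT.
congr (~~ _); apply/imsetP/eqP => [[j _ zj]|->]; last by exists i.
by rewrite -zi zj col_transversal.
Qed.

Lemma rooted_root g r i : r \in transversals -> g \in family (rooted r) ->
  g (r i) = r (ordS i).
Proof.
move=> rT /familyP /(_ (r i)).
by rewrite /rooted col_transversal // eqxx inE => /eqP.
Qed.

Lemma rooted_targets g r : r \in transversals -> g \in family (rooted r) ->
  g \in family (targets [set: Z]).
Proof.
move=> rT /familyP gr; apply/familyP => z; have := gr z.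
rewrite /rooted; case: eqP => // _; rewrite !inE => /eqP ->.
by rewrite col_transversal /=.
Qed.

Lemma roots_invariant g r : r \in transversals -> g \in family (rooted r) ->
  {in roots r, forall z, g z \in roots r}.
Proof.
by move=> rT gr _ /imsetP[i _ ->]; rewrite (rooted_root i rT gr) imset_f.
Qed.

Lemma targets_col g z : g \in family (targets [set: Z]) -> col (g z) = ordS (col z).
Proof. by move=> /familyP /(_ z); rewrite !inE => /eqP. Qed.

(** The roots of [r'] form an invariant set, which cannot avoid those of [r]. A common point has the
    same index in both, and [g] carries the agreement to all colors. *)
Lemma attractor_inj g r r' : (0 < k)%N -> attractor g r -> attractor g r' -> r = r'.
Proof.
move=> k_gt0 /and3P[rT gr ntrap] /and3P[rT' gr' _].
have /exists_inP[_ /imsetP[j _ ->] rj] : [exists z in roots r', z \in roots r].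
  apply: contraNT ntrap => /exists_inPn dis; apply/trapP; exists (roots r'); split.
  - by exists (r' (Ordinal k_gt0)); apply: imset_f.
  - by apply/subsetP => z /dis; rewrite inE.
  - exact: roots_invariant.
have {rj} rj : r' j = r j.
  case/imsetP: rj => i _ e; have := congr1 col e.
  by rewrite !col_transversal // e => ->.
apply/ffunP => i; have [m <-] := iter_ordS_reach j i.
by elim: m => //= m IHm; rewrite -(rooted_root _ rT gr) -(rooted_root _ rT' gr') IHm.
Qed.

Lemma card_attractor r : (0 < k)%N -> r \in transversals ->
  #|[set g | attractor g r]|%:R =
  #|family (targets [set: Z])|%:R * (\prod_i #|colored [set: Z] i|%:R^-1) *
  (1 - \prod_i (1 - #|colored [set: Z] i|%:R^-1)) :> F.
Proof.
move=> k_gt0 rT.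
have rcol i : r i \in colored [set: Z] i by rewrite !inE col_transversal /=.
have c0 i : #|colored [set: Z] i|%:R != 0 :> F.
  by rewrite pnatr_eq0 cards_eq0; apply/set0Pn; exists (r i).
(* Prescribing the image of each root replaces one factor of every color size by 1. *)
have -> : #|family (targets [set: Z])|%:R * (\prod_i #|colored [set: Z] i|%:R^-1) =
    #|family (rooted r)|%:R :> F.
  rewrite !natr_card_family (reindex_inj (@ordS_inj k)) /=.
  have := prod_section
    (fun z => #|colored [set: Z] (ordS (col z))|%:R^-1) (col_transversal rT).
  under eq_bigr do rewrite col_transversal //.
  move=> ->; rewrite -big_split /=; apply: eq_bigr => z _.
  by rewrite /rooted /targets; case: eqP; rewrite ?mulr1 ?cards1 ?divff.
rewrite mulrBr mulr1.
have -> : \prod_i (1 - #|colored [set: Z] i|%:R^-1) =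
    \prod_i (#|colored (~: roots r) i|%:R / #|colored [set: Z] i|%:R) :> F.
  apply: eq_bigr => i _; rewrite colored_setC_roots // (cardsD1 (r i) (colored _ i)) rcol.
  have := c0 i; rewrite (cardsD1 (r i) (colored _ i)) rcol natrD => ci.
  by rewrite -{1}(divff ci) mulrDl mul1r addrAC subrr add0r.
rewrite -card_trap //; last first.
  move=> z; rewrite inE /rooted => zr; rewrite ifN //.
  by apply: contra zr => /eqP ->; apply: imset_f.
apply/eqP; rewrite eq_sym subr_eq -natrD eqr_nat -cardsUI.
apply/eqP; rewrite -[LHS]addn0; congr (_ + _)%N; last first.
  apply/esym/eqP; rewrite cards_eq0; apply/eqP/setP => g; rewrite !inE /attractor.
  by case: (trap _ _); rewrite ?andbF.
apply: eq_card => g; rewrite !inE /attractor rT.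
by case: (trap _ _); rewrite ?andbF ?andbT ?orbF ?orbT.
Qed.

Lemma card_attracted (k_gt0 : (0 < k)%N) :
    (forall i, colored [set: Z] i != set0) ->
  #|[set g | [exists r, attractor g r]]|%:R =
  #|family (targets [set: Z])|%:R * (1 - \prod_i (1 - #|colored [set: Z] i|%:R^-1)) :> F.
Proof.
move=> c0.
(* By [attractor_inj], each attracted map is counted for exactly one transversal. *)
have -> : #|[set g | [exists r, attractor g r]]| =
    (\sum_(r in transversals) #|[set g | attractor g r]|)%N.
  under eq_bigr do rewrite -sum1_card big_mkcond.
  rewrite exchange_big /= -sum1_card big_mkcond; apply: eq_bigr => g _.
  rewrite inE; case: existsP => [[r gr]|ngr].
    have rT : r \in transversals by case/and3P: gr.
    rewrite (bigD1 r) //= inE gr big1 // => r' /andP[_ r'r].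
    by rewrite inE; case: ifP => // /(attractor_inj k_gt0 gr) e; rewrite e eqxx in r'r.
  by rewrite big1 // => r _; rewrite inE; case: ifP => // gr; case: ngr; exists r.
rewrite natr_sum (eq_bigr _ (fun r => @card_attractor r k_gt0)) sumr_const.
rewrite -[_ *+ _]mulr_natr (natr_card_family (colored _)) prodfV mulrAC mulfVK //.
by apply/prodf_neq0 => i _; rewrite pnatr_eq0 cards_eq0.
Qed.

Lemma attractedP g (k_gt0 : (0 < k)%N) : g \in family (targets [set: Z]) ->
  (exists r, attractor g r) <->
  exists2 m, (0 < m)%N & exists2 c, col c = Ordinal k_gt0 &
    forall z, col z = Ordinal k_gt0 -> iter (m * k) g z = c.
Proof.
set i0 := Ordinal k_gt0 => gT.
have invT : {in [set: Z], forall z, g z \in [set: Z]} by move=> z; rewrite !inE.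
have colT : {in [set: Z], forall z, col (g z) = ordS (col z)}.
  by move=> z _; apply: targets_col.
have col_iterT z m : col (iter m g z) = iter m (@ordS k) (col z).
  by apply: (col_iter m invT colT); rewrite inE.
split=> [[r /and3P[rT gr ntrap]]|[m m0 [c c0 gc]]].
  (* A point that reaches a root does so in fewer than [#|Z|] steps and stays among the roots; after
     a multiple of [k] steps its color decides which root it is on. *)
  exists #|Z|; first by apply/card_gt0P; exists (r i0).
  exists (r i0); first exact: col_transversal.
  move=> z zi0.
  have /existsP[i zi] : [exists i, fconnect g z (r i)].
    apply: contraNT ntrap => nz; apply/trapP.
    (* The points whose orbit never meets a root would form a trap. *)
    exists [set w | ~~ [exists i, fconnect g w (r i)]]; split.
    - by exists z; rewrite inE.
    - apply/subsetP => w; rewrite !inE; apply: contra => /imsetP[i _ ->].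
      by apply/existsP; exists i; apply: connect0.
    - move=> w; rewrite !inE; apply: contra => /existsP[i wi].
      by apply/existsP; exists i; apply: connect_trans wi; apply: fconnect1.
  have le : (findex g z (r i) <= #|Z| * k)%N.
    apply: ltnW; apply: leq_trans (findex_max zi) _.
    by apply: leq_trans (max_card _) _; rewrite leq_pmulr.
  have : iter (#|Z| * k) g z \in roots r.
    rewrite -(subnK le) iterD iter_findex //.
    by apply: iter_invariant; [exact: roots_invariant|exact: imset_f].
  case/imsetP => j _ e; rewrite e; congr (r _).
  have := congr1 col e; rewrite col_transversal // => <-.
  by apply: val_inj; rewrite col_iterT /= iter_ordS_val zi0 add0n modnMl.
have iter_col i n : col (iter n g c) = i -> val i = (n %% k)%N.
  by move=> <-; rewrite col_iterT /= iter_ordS_val c0.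
(* The [k]-th iterate commutes with the [m * k]-th, which sends every point of color [i0] to [c]. *)
have gkc : iter k g c = c.
  rewrite -{1}(gc c c0) -iterD addnC iterD gc //.
  by apply: val_inj; rewrite (iter_col _ k erefl) modnn.
pose r := [ffun i : 'I_k => iter i g c].
have rT : r \in transversals.
  apply/familyP => i; rewrite !inE ffunE /=; apply/eqP/val_inj => /=.
  by rewrite (iter_col _ i erefl) modn_small.
exists r; apply/and3P; split => //.
  apply/familyP => z; rewrite /rooted; case: eqP => [zr|_]; last exact: (familyP gT).
  rewrite inE [in g z]zr !ffunE -iterS /=; apply/eqP.
  (* Only the wrap-around from the last color to the first needs [gkc]. *)
  have [lt|ge] := ltnP (col z).+1 k; first by rewrite modn_small.
  have e : (col z).+1 = k by apply/eqP; rewrite eqn_leq ge ltn_ord.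
  have ge_c : iter (col z).+1 g c = c by rewrite e.
  by rewrite e modnn -[RHS]ge_c.
(* An invariant set has a point of color [i0], hence contains [c], which is the root [r i0]. *)
apply/negP => /trapP[A [[z zA] /subsetP Ar gA]].
have [|w wA wi] := @invariant_colored A g z i0 gA _ zA.
  by move=> y _; apply: targets_col.
have := Ar c; rewrite -(gc w wi) iter_invariant // => /(_ isT).
by rewrite gc // inE => /imsetP; case; exists i0; rewrite // ffunE.
Qed.

End Traps.
From mathcomp Require Import all_classical all_reals all_analysis.
Import numFieldNormedType.Exports.

(** * Tuples of functions as color-raising maps of the disjoint union *)

Section TupleAsMap.
Variables (k : nat) (X : 'I_k -> finType).
Let Z : finType := {i : 'I_k & X i}.
Let col : Z -> 'I_k := fun u => tag u.

Definition union_map (f : ftuple X) : {ffun Z -> Z} := [ffun u => fstep f u].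

Lemma union_map_inj : injective union_map.
Proof.
move=> f f' ff'; apply/ffunP => i; apply/ffunP => x.
apply: (@eq_from_Tagged _ X).
by have := congr1 (fun h : {ffun Z -> Z} => h (Tagged X x)) ff'; rewrite !ffunE.
Qed.

(** With [union_map_inj], this puts the tuples in bijection with the color-raising maps, so the
    probability can be computed there. *)
Lemma mem_union_map (g : {ffun Z -> Z}) :
  (g \in codom union_map) = (g \in family (targets col [set: Z])).
Proof.
apply/codomP/idP => [[f ->]|gT].
  by apply/familyP => u; rewrite ffunE !inE /= eqxx.
have gcol i (x : X i) : tag (g (Tagged X x)) = ordS i by apply: (targets_col (Tagged X x) gT).
exists [ffun i => [ffun x => etagged (gcol i x)]]; apply/ffunP => -[i x].
by rewrite ffunE /fstep /= ffunE /= ffunE etaggedK.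
Qed.

Lemma card_colored_tag i : #|colored col [set: Z] i| = #|X i|.
Proof.
rewrite -(card_imset _ (@eq_from_Tagged _ X i)); apply: eq_card => u.
rewrite !inE /=; apply/eqP/imsetP => [<-|[x _ ->]] //.
by exists (tagged u); rewrite ?taggedK.
Qed.

Lemma iter_fcomposite (f : ftuple X) i (x : X i) m :
  Tagged X (iter m (@fcomposite k X f i) x) = iter (m * k) (union_map f) (Tagged X x).
Proof.
have -> : iter (m * k) (union_map f) (Tagged X x) = iter (m * k) (fstep f) (Tagged X x).
  by apply: eq_iter => u; rewrite ffunE.
elim: m => //= m IHm.
by rewrite mulSn iterD -IHm /fcomposite etaggedK.
Qed.

Lemma eventually_constantP (k_gt0 : (0 < k)%N) (f : ftuple X) :
  eventually_constant k_gt0 f <-> exists r, attractor col (union_map f) r.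
Proof.
rewrite (attractedP k_gt0); last by rewrite -mem_union_map codom_f.
split=> -[m m0 [c]].
  move=> mc; exists m => //; exists (Tagged X c) => // -[i x] /= xi.
  (* Eliminating [xi] moves [x] into the fiber over the first index, where [mc] applies. *)
  by case: _ / (esym xi) in x *; rewrite -iter_fcomposite mc.
case: c => i c /= ci; case: _ / (esym ci) in c * => mc.
exists m => //; exists c => x; apply: (@eq_from_Tagged _ X).
by rewrite iter_fcomposite mc.
Qed.

Lemma prob_eventually_constantE (R : realType) (k_gt0 : (0 < k)%N) :
    (forall i, 0 < #|X i|)%N ->
  prob_eventually_constant X R k_gt0 = 1 - \prod_i (1 - #|X i|%:R^-1).
Proof.
move=> X0; rewrite /prob_eventually_constant.
have fam0 : #|family (targets col [set: Z])|%:R != 0 :> R.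
  rewrite natr_card_family; apply/prodf_neq0 => z _.
  by rewrite /targets card_colored_tag pnatr_eq0 -lt0n.
have -> : #|ftuple X| = #|family (targets col [set: Z])|.
  by rewrite -(card_codom union_map_inj); apply: eq_card => g; rewrite mem_union_map.
rewrite -(card_imset _ union_map_inj).
set E := imset _ _.
have -> : E = [set g : {ffun Z -> Z} | [exists r, attractor col g r]].
  apply/setP => g; rewrite inE; apply/imsetP/existsP => [[f + ->]|[r gr]].
    by rewrite inE => /asboolP /eventually_constantP.
  have /codomP[f gf] : g \in codom union_map.
    by rewrite mem_union_map; case/and3P: gr => rT gr _; apply: rooted_targets rT gr.
  exists f => //; rewrite inE; apply/asboolP/eventually_constantP.
  by exists r; rewrite -gf.
rewrite card_attracted //; last first.
  by move=> i; rewrite -card_gt0 card_colored_tag.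
rewrite mulrC mulKf //; congr (_ - _); apply: eq_bigr => i _.
by rewrite card_colored_tag.
Qed.

End TupleAsMap.

(** * The quadratic error bound and the asymptotics *)

Lemma bernoulli_error (R : realDomainType) (x : R) k : 0 <= x <= 1 ->
  `|1 - (1 - x) ^+ k - k%:R * x| <= k%:R ^+ 2 * x ^+ 2.
Proof.
case/andP=> x0 x1; suff: 0 <= (1 - x) ^+ k - 1 + k%:R * x <= k%:R ^+ 2 * x ^+ 2.
  by case/andP=> ? ?; rewrite -normrN ger0_norm; lra.
elim: k => [|k /andP[IH0 IH1]]; first by rewrite expr0 !mul0r expr0n /= !mul0r; lra.
have k0 : 0 <= k%:R :> R by [].
rewrite exprS -natr1; set e := _ ^+ k in IH0 IH1 *.
(* The error is multiplied by [1 - x], at most 1, and gains [k x^2]; the bound survives because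
   [k^2 + k <= (k + 1)^2]. *)
have -> : (1 - x) * e - 1 + (k%:R + 1) * x =
    (e - 1 + k%:R * x) * (1 - x) + k%:R * x ^+ 2 by ring.
apply/andP; split; first by rewrite addr_ge0 ?mulr_ge0 ?exprn_ge0 // subr_ge0.
have : (e - 1 + k%:R * x) * (1 - x) <= k%:R ^+ 2 * x ^+ 2.
  by rewrite (le_trans _ IH1) // ler_piMr //; lra.
have : 0 <= k%:R * x ^+ 2 by rewrite mulr_ge0 ?exprn_ge0.
have : 0 <= x ^+ 2 by rewrite exprn_ge0.
have -> : (k%:R + 1) ^+ 2 * x ^+ 2 =
    k%:R ^+ 2 * x ^+ 2 + k%:R * x ^+ 2 *+ 2 + x ^+ 2 by ring.
lra.
Qed.

Local Open Scope classical_set_scope.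

Theorem corollary3p8 (R : realType) (k : nat) (k_gt0 : (0 < k)%N)
    (X : nat -> 'I_k -> finType)
    (cardX : forall n : nat, (1 <= n)%N -> forall i : 'I_k, #|X n i| = n) :
  let p : nat -> R := fun n => prob_eventually_constant (X n) R k_gt0 in
  (forall n : nat, (1 <= n)%N -> p n = 1 - (1 - 1 / n%:R) ^+ k) /\
  p = (fun n : nat => k%:R / n%:R : R) +O_\oo (fun n : nat => 1 / n%:R ^+ 2 : R).
Proof.
move=> p.
have pE n : (1 <= n)%N -> p n = 1 - (1 - 1 / n%:R) ^+ k.
  move=> n0; rewrite /p prob_eventually_constantE => [|i]; last by rewrite cardX.
  under eq_bigr do rewrite cardX //.
  by rewrite prodr_const card_ord div1r.
(* Any [M >= k^2] serves as the constant, by [bernoulli_error] at [x = 1/n]. *)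
split=> //; apply/eqaddOP; near=> M; near=> n.
have n0 : (1 <= n)%N by near: n; exists 1%N.
rewrite [(p - _) n]/(p n - k%:R / n%:R) pE // div1r.
have := @bernoulli_error R n%:R^-1 k.
rewrite invr_ge0 ler0n invf_le1 ?ltr0n // ler1n n0 => /(_ isT) /le_trans; apply.
rewrite div1r ger0_norm ?invr_ge0 ?exprn_ge0 // exprVn ler_wpM2r ?invr_ge0 ?exprn_ge0 //.
Unshelve. all: by end_near.
Qed.
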